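(* Let $\mathcal{H}^{(2)}=\int \omega_k |z_k|^2\,dk$ and $\mathcal{H}^{(3)}_{\rm NoRes}=\mathcal{H}^{(3)}-\mathcal{H}^{(3)}_{\rm Res}$ be the functionals defined in the context. The cohomological equation $$\{K^{(3)},\mathcal{H}^{(2)}\}=\mathcal{H}^{(3)}_{\rm NoRes}$$ has a unique solution $K^{(3)}$ which, in the complex symplectic coordinates, is $$K^{(3)}=\frac{1}{8i\sqrt{\pi}}\int S_{123}\Big[\frac{z_1z_2z_3-\bar z_{-1}\bar z_{-2}\bar z_{-3}}{\omega_1+\omega_2+\omega_3}-2\,\frac{z_1z_2\bar z_{-3}-\bar z_{-1}\bar z_{-2}z_3}{\omega_1+\omega_2-\omega_3}+\big(1-\chi_{\mathcal{N}_\mu}(k_1,k_2,k_3)\big)\frac{z_1\bar z_{-2}z_3-\bar z_{-1}z_2\bar z_{-3}}{\omega_1-\omega_2+\omega_3}\Big]\delta_{123}\,dk_{123}.$$ Alternatively, in the variables $(\eta,\xi)$, $$K^{(3)}=\frac{1}{\sqrt{2\pi}}\int\big(P_{123}\,\eta_1\eta_2\xi_3+Q_{123}\,\eta_1\xi_2\eta_3+R_{123}\,\xi_1\xi_2\xi_3\big)\delta_{123}\,dk_{123},$$ with coefficients $$P_{123}=\frac{1+\operatorname{sgn}(k_1)\operatorname{sgn}(k_3)}{4\,\widetilde d(k_1,k_3)}\,a_1^2\Big(4\omega_1(\omega_1^2-\omega_2^2-\omega_3^2)-\chi_{\mathcal{N}_\mu}(k_1,k_2,k_3)\,\Pi_{123}\Big),$$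 $$Q_{123}=\frac{1+\operatorname{sgn}(k_1)\operatorname{sgn}(k_3)}{8\,\widetilde d(k_1,k_3)}\Big(\frac{a_1^2a_3^2}{a_2^2}\Big)\Big(8\omega_1\omega_2\omega_3+\chi_{\mathcal{N}_\mu}(k_1,k_2,k_3)\,\Pi_{123}\Big),$$ $$R_{123}=\frac{1+\operatorname{sgn}(k_1)\operatorname{sgn}(k_3)}{8\,\widetilde d(k_1,k_3)}\Big(\frac{1}{a_2^2}\Big)\Big(4\omega_2(\omega_1^2-\omega_2^2+\omega_3^2)-\chi_{\mathcal{N}_\mu}(k_1,k_2,k_3)\,\Pi_{123}\Big),$$ where $\Pi_{123}:=(\omega_1+\omega_2+\omega_3)(\omega_1+\omega_2-\omega_3)(\omega_1-\omega_2-\omega_3)$.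
   Context: Parameters: $g,\mathcal{D},\mathcal{P}$ are real constants, in dimensionless units $g=1$, $\mathcal{D}=1$ and $0\le\mathcal{P}<2$ (the symbols $g,\mathcal D$ are kept). For $k\in\mathbb{R}$, $\omega_k=\omega(k)=\sqrt{|k|(g-\mathcal{P}k^2+\mathcal{D}k^4)}$ and $a_k=a(k)>0$ with $a_k^2=\omega_k/|k|$. Variables: $\eta(x),\xi(x)$ are real-valued functions with Fourier transforms $\eta_k,\xi_k$, where $f_k=\frac{1}{\sqrt{2\pi}}\int e^{-ikx}f(x)\,dx$, so $\eta_{-k}=\overline{\eta_k}$, $\xi_{-k}=\overline{\xi_k}$; moreover $\eta_0=0$. Complex symplectic coordinates: $z_k=\frac{1}{\sqrt2}(a_k\eta_k+i a_k^{-1}\xi_k)$, $\bar z_{-k}=\frac{1}{\sqrt2}(a_k\eta_k-i a_k^{-1}\xi_k)$. Notation: a subscript $j$ stands for $k_j$ and $\pm j$ for $\pm k_j$ (e.g. $z_{\pm j}=z_{\pm k_j}$, $\omega_j=\omega_{k_j}$, $a_j=a_{k_j}$); $dk_{123}=dk_1dk_2dk_3$, $\delta_{123}=\delta(k_1+k_2+k_3)$ with $\delta$ the Dirac distribution; all integrals are over $\mathbb{R}$ in each variable. All computations are formal manipulations of such functionals. Poisson bracket: $\{K,H\}=\frac1i\int\big(\partial_{z_{k_1}}H\,\partial_{\bar z_{-k_2}}K-\partial_{\bar z_{-k_1}}H\,\partial_{z_{k_2}}K\big)\delta(k_1+k_2)\,dk_1dk_2$. The unknown $K^{(3)}$ is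 sought as a functional homogeneous of degree $3$. Kernel: $S_{123}=S(k_1,k_2,k_3)=(k_1k_3+|k_1||k_3|)\frac{a_1a_3}{a_2}$. Cubic Hamiltonian: $\mathcal{H}^{(3)}=\frac{1}{8\sqrt\pi}\int S_{123}(z_1-\bar z_{-1})(z_2+\bar z_{-2})(z_3-\bar z_{-3})\delta_{123}\,dk_{123}$. Its resonant part is $\mathcal{H}^{(3)}_{\rm Res}=\frac{1}{8\sqrt\pi}\int\chi_{\mathcal{N}_\mu}(k_1,k_2,k_3)S_{123}\,(z_1\bar z_{-2}z_3+\bar z_{-1}z_2\bar z_{-3})\delta_{123}\,dk_{123}$. Resonant set and its neighborhood: let $$\widetilde d(k_1,k_3)=k_1k_3(k_1+k_3)^2\big(3\mathcal{P}-5\mathcal{D}(k_1^2+k_1k_3+k_3^2)\big)^2-4(g-\mathcal{P}k_1^2+\mathcal{D}k_1^4)(g-\mathcal{P}k_3^2+\mathcal{D}k_3^4).$$ Let $\mathcal{C}^+$ be the curve of roots of $\widetilde d(k_1,k_3)=0$ with $k_1,k_3>0$. For small $\mu>0$ let $\mathcal{C}^+_\mu=\{(k_1,k_3)+\mu t\,\vec n(k_1,k_3): t\in[-1,1],\ (k_1,k_3)\in\mathcal{C}^+\}\cap\{(x,y):x\ge0,y\ge0\}$, where $\vec n(k_1,k_3)$ is a (unit) normal vector to $\mathcal{C}^+$ at $(k_1,k_3)$; let $\mathcal{C}^-_\mu=-\mathcal{C}^+_\mu$ and $\mathcal{C}_\mu=\mathcal{C}^+_\mu\cup\mathcal{C}^-_\mu$.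 Then $\mathcal{N}_\mu=\{(k_1,-k_1-k_3,k_3):(k_1,k_3)\in\mathcal{C}_\mu\}$, and $\chi_{\mathcal{N}_\mu}$ is its characteristic function ($1$ on $\mathcal{N}_\mu$, $0$ elsewhere). *)

(* Defs.v *)
From mathcomp Require Import all_boot all_order all_algebra.
From mathcomp Require Import all_classical all_reals all_analysis.
From mathcomp Require Import complex.

Set Implicit Arguments.
Unset Strict Implicit.
Unset Printing Implicit Defensive.

Import Order.TTheory GRing.Theory Num.Theory.
Import numFieldNormedType.Exports.

Local Open Scope classical_set_scope.
Local Open Scope complex_scope.
Local Open Scope ring_scope.

(* Formal calculus of functionals.

   Fix a set L of field symbols.  A letter (l, k) : L * R is the value at the
   wave number k of the field l.  A functional is given by its kernels,
   indexed by words of letters: F : functional R L stands for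
     \sum_n \sum_(l1, ..., ln) \int F [:: (l1, k1); ...; (ln, kn)]
        l1(k1) ... ln(kn) delta(k1 + ... + kn) dk1 ... dkn .
   Letters commute, so a functional only determines the symmetrization of its
   kernels, almost everywhere on the plane k1 + ... + kn = 0; see eq_cubic.  As in any
   formal computation z and \bar z are independent and no convergence is
   required: a kernel with denominator omega_1 + omega_2 - omega_3 need not be
   locally integrable when P is close to 2. *)

Definition functional (R : realType) (L : Type) := seq (L * R) -> R[i].

(* (Z, k) is z_k, but (Zbar, k) is \bar z_{-k}. *)
Inductive zvar := Z | Zbar.

(* (Eta, k) is eta_k and (Xi, k) is xi_k. *)
Inductive pvar := Eta | Xi.

Section Calculus.
Context {R : realType}.
Local Notation C := R[i].

Definition homogeneous (L : Type) (n : nat) (F : functional R L) :=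
  forall w, size w != n -> F w = 0.

(* The integral over k1, k2, k3 of f k1 k2 k3 against delta(k1 + k2 + k3),
   where f k1 k2 k3 l1 l2 l3 is the coefficient of l1(k1) l2(k2) l3(k3). *)
Definition cubic_int (L : Type) (f : R -> R -> R -> L -> L -> L -> C) :
    functional R L := fun w =>
  match w with
  | [:: (l1, k1); (l2, k2); (l3, k3)] => f k1 k2 k3 l1 l2 l3
  | _ => 0
  end.

(* The plane k1 + k2 + k3 = 0 is parametrized by (k1, k3). *)
Definition measurable_cubic (L : Type) (F : functional R L) :=
  forall l1 l2 l3 : L,
    let f (p : R * R) := F [:: (l1, p.1); (l2, - p.1 - p.2); (l3, p.2)] in
    measurable_fun setT (fun p => complex.Re (f p)) /\
    measurable_fun setT (fun p => complex.Im (f p)).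

Definition cubic_functional (L : Type) (F : functional R L) :=
  homogeneous 3 F /\ measurable_cubic F.

Definition sym3 (L : Type) (F : functional R L) (x y t : L * R) : C :=
  F [:: x; y; t] + F [:: x; t; y] + F [:: y; x; t] +
  F [:: y; t; x] + F [:: t; x; y] + F [:: t; y; x].

(* Equality of the cubic parts of two functionals. *)
Definition eq_cubic (L : Type) (F G : functional R L) :=
  {ae (@lebesgue_measure R \x @lebesgue_measure R)%E, forall p : R * R,
    forall l1 l2 l3 : L,
    sym3 F (l1, p.1) (l2, - p.1 - p.2) (l3, p.2) =
    sym3 G (l1, p.1) (l2, - p.1 - p.2) (l3, p.2)}.

Definition fadd (L : Type) (F G : functional R L) : functional R L :=
  fun w => F w + G w.
Definition fopp (L : Type) (F : functional R L) : functional R L :=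
  fun w => - F w.

(* The functional derivative with respect to the letter x = (l, k): Leibniz'
   rule removes one occurrence of the field l, evaluated at k.  The result is
   the kernel of a functional with delta(k + k1 + ... + kn). *)
Definition fderiv (L : Type) (x : L * R) (F : functional R L) :
    functional R L := fun w =>
  \sum_(i < (size w).+1) F (take i w ++ x :: drop i w).

Definition momentum (L : Type) (w : seq (L * R)) : R := \sum_(x <- w) x.2.

(* {K, H} = 1/i \int (d_{z_{k1}} H  d_{\bar z_{-k2}} K
                      - d_{\bar z_{-k1}} H  d_{z_{k2}} K) delta(k1 + k2).
   In the product of the derivatives, the word u comes from H and v from K,
   with factors delta(k1 + momentum u) and delta(k2 + momentum v); integrating
   out k1 and k2 sets k1 = - momentum u, k2 = - k1 and leaves
   delta(momentum u + momentum v). *)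
Definition poisson (K H : functional R zvar) : functional R zvar := fun w =>
  ('i%C)^-1 * \sum_(j < (size w).+1)
    let u := take j w in let v := drop j w in
    let k1 := - momentum u in let k2 := - k1 in
    fderiv (Z, k1) H u * fderiv (Zbar, k2) K v
    - fderiv (Zbar, k1) H u * fderiv (Z, k2) K v.

(* The coefficients of the integrands z and zbar on a slot holding the symbol
   x, so that e.g. (z x1 - zb x1) * zb x2 is the coefficient of x1 x2 in
   (z_1 - \bar z_{-1}) \bar z_{-2}. *)
Definition z (x : zvar) : C := if x is Z then 1 else 0.
Definition zb (x : zvar) : C := if x is Zbar then 1 else 0.
Definition eta (y : pvar) : C := if y is Eta then 1 else 0.
Definition xi (y : pvar) : C := if y is Xi then 1 else 0.

End Calculus.

Section Model.
Context {R : realType}.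
Context (g D P : R).
Local Notation C := R[i].

Definition omega (k : R) : R :=
  Num.sqrt (`|k| * (g - P * k ^+ 2 + D * k ^+ 4)).

Definition a (k : R) : R := Num.sqrt (omega k / `|k|).

Definition Sker (k1 k2 k3 : R) : R :=
  (k1 * k3 + `|k1| * `|k3|) * (a k1 * a k3 / a k2).

Definition dtilde (k1 k3 : R) : R :=
  k1 * k3 * (k1 + k3) ^+ 2
    * (3 * P - 5 * D * (k1 ^+ 2 + k1 * k3 + k3 ^+ 2)) ^+ 2
  - 4 * (g - P * k1 ^+ 2 + D * k1 ^+ 4) * (g - P * k3 ^+ 2 + D * k3 ^+ 4).

Definition Cplus : set (R * R) :=
  [set p | [/\ 0 < p.1, 0 < p.2 & dtilde p.1 p.2 = 0]].

(* A unit vector collinear with the gradient of dtilde at p; at a singular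
   point of the curve every unit vector qualifies. *)
Definition unit_normal (p n : R * R) :=
  n.1 ^+ 2 + n.2 ^+ 2 = 1 /\
  n.1 * derive1 (fun y => dtilde p.1 y) p.2 =
  n.2 * derive1 (fun x => dtilde x p.2) p.1.

Definition Cplus_mu (mu : R) : set (R * R) :=
  [set q | [/\ 0 <= q.1, 0 <= q.2 & exists p n : R * R, exists t : R,
    [/\ Cplus p, unit_normal p n, -1 <= t <= 1 &
        q = (p.1 + mu * t * n.1, p.2 + mu * t * n.2)]]].

Definition C_mu (mu : R) : set (R * R) :=
  [set q | Cplus_mu mu q \/ Cplus_mu mu (- q.1, - q.2)].

Definition N_mu (mu : R) : set (R * R * R) :=
  [set k | exists2 q, C_mu mu q & k = (q.1, - q.1 - q.2, q.2)].

Definition chi (mu k1 k2 k3 : R) : R := \1_(N_mu mu) (k1, k2, k3).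

(* \int omega_k |z_k|^2 dk, where |z_k|^2 = z_k \bar z_{-(-k)}. *)
Definition H2 : functional R zvar := fun w =>
  match w with
  | [:: (Z, k); (Zbar, _)] => (omega k)%:C
  | _ => 0
  end.

Definition H3 : functional R zvar := cubic_int (fun k1 k2 k3 x1 x2 x3 =>
  (8 * Num.sqrt pi)^-1%:C * (Sker k1 k2 k3)%:C
    * ((z x1 - zb x1) * (z x2 + zb x2) * (z x3 - zb x3))).

Definition H3Res (mu : R) : functional R zvar :=
  cubic_int (fun k1 k2 k3 x1 x2 x3 =>
  (8 * Num.sqrt pi)^-1%:C * (chi mu k1 k2 k3)%:C * (Sker k1 k2 k3)%:C
    * (z x1 * zb x2 * z x3 + zb x1 * z x2 * zb x3)).

Definition H3NoRes (mu : R) : functional R zvar := fadd H3 (fopp (H3Res mu)).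

Definition K3 (mu : R) : functional R zvar :=
  cubic_int (fun k1 k2 k3 x1 x2 x3 =>
  let w1 := omega k1 in let w2 := omega k2 in let w3 := omega k3 in
  ((8 * Num.sqrt pi)%:C * 'i%C)^-1 * (Sker k1 k2 k3)%:C
    * ((z x1 * z x2 * z x3 - zb x1 * zb x2 * zb x3) / (w1 + w2 + w3)%:C
       - 2 * ((z x1 * z x2 * zb x3 - zb x1 * zb x2 * z x3)
              / (w1 + w2 - w3)%:C)
       + (1 - chi mu k1 k2 k3)%:C
         * ((z x1 * zb x2 * z x3 - zb x1 * z x2 * zb x3)
            / (w1 - w2 + w3)%:C))).

(* z_k = (a_k eta_k + i a_k^-1 xi_k) / sqrt 2 and
   \bar z_{-k} = (a_k eta_k - i a_k^-1 xi_k) / sqrt 2. *)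
Definition zcoord (x : zvar) (k : R) (y : pvar) : C :=
  (Num.sqrt 2)^-1%:C *
  match x with
  | Z => (a k)%:C * eta y + 'i%C * (a k)^-1%:C * xi y
  | Zbar => (a k)%:C * eta y - 'i%C * (a k)^-1%:C * xi y
  end.

(* The same functional in the variables (eta, xi): substitute zcoord in every
   slot and expand the product. *)
Fixpoint to_etaxi_rec (F : functional R zvar) (w : seq (pvar * R)) : C :=
  match w with
  | [::] => F [::]
  | (y, k) :: w' =>
      zcoord Z k y * to_etaxi_rec (fun u => F ((Z, k) :: u)) w'
      + zcoord Zbar k y * to_etaxi_rec (fun u => F ((Zbar, k) :: u)) w'
  end.

Definition to_etaxi (F : functional R zvar) : functional R pvar :=
  to_etaxi_rec F.

Definition Pi3 (k1 k2 k3 : R) : R :=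
  let w1 := omega k1 in let w2 := omega k2 in let w3 := omega k3 in
  (w1 + w2 + w3) * (w1 + w2 - w3) * (w1 - w2 - w3).

Definition coefP (mu k1 k2 k3 : R) : R :=
  let w1 := omega k1 in let w2 := omega k2 in let w3 := omega k3 in
  (1 + Num.sg k1 * Num.sg k3) / (4 * dtilde k1 k3) * a k1 ^+ 2
  * (4 * w1 * (w1 ^+ 2 - w2 ^+ 2 - w3 ^+ 2) - chi mu k1 k2 k3 * Pi3 k1 k2 k3).

Definition coefQ (mu k1 k2 k3 : R) : R :=
  let w1 := omega k1 in let w2 := omega k2 in let w3 := omega k3 in
  (1 + Num.sg k1 * Num.sg k3) / (8 * dtilde k1 k3)
  * (a k1 ^+ 2 * a k3 ^+ 2 / a k2 ^+ 2)
  * (8 * w1 * w2 * w3 + chi mu k1 k2 k3 * Pi3 k1 k2 k3).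

Definition coefR (mu k1 k2 k3 : R) : R :=
  let w1 := omega k1 in let w2 := omega k2 in let w3 := omega k3 in
  (1 + Num.sg k1 * Num.sg k3) / (8 * dtilde k1 k3) * (1 / a k2 ^+ 2)
  * (4 * w2 * (w1 ^+ 2 - w2 ^+ 2 + w3 ^+ 2) - chi mu k1 k2 k3 * Pi3 k1 k2 k3).

Definition K3etaxi (mu : R) : functional R pvar :=
  cubic_int (fun k1 k2 k3 y1 y2 y3 =>
  (Num.sqrt (2 * pi))^-1%:C
  * ((coefP mu k1 k2 k3)%:C * (eta y1 * eta y2 * xi y3)
     + (coefQ mu k1 k2 k3)%:C * (eta y1 * xi y2 * eta y3)
     + (coefR mu k1 k2 k3)%:C * (xi y1 * xi y2 * xi y3))).

End Model.

(* Main.v *)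
Require Import Defs.
From mathcomp Require Import all_boot all_order all_algebra.
From mathcomp Require Import all_classical all_reals all_analysis.
From mathcomp Require Import measurable_realfun complex.
From mathcomp Require Import ring lra.

Import Order.TTheory GRing.Theory Num.Theory.
Import numFieldNormedType.Exports.
Local Open Scope classical_set_scope.
Local Open Scope complex_scope.
Local Open Scope ring_scope.

(** The coefficients of a functional count only after symmetrization and almost
    everywhere, so all identities are proved at [regular] wave numbers:
    nonzero, of zero sum, and with no pair on the curve [dtilde = 0].

    The small divisors are the four combinations [w1 +- w2 +- w3] of the
    frequencies.  Their product [heron w1 w2 w3] is a polynomial in the squares
    of the frequencies, hence in the wave numbers once the signs are known: it
    is [k1 * k3 * dtilde k1 k3] when [k1] and [k3] have the same sign
    ([heron_dtilde]).  Among three nonzero numbers of zero sum two have the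
    same sign, so no divisor vanishes at regular wave numbers
    ([regular_denominators]).  For a fixed [x], [dtilde x y] is a nonzero
    polynomial in [y], because [dtilde x 0 < 0] when [P < 2]; its zero set is
    finite, and by Fubini almost all wave numbers are regular ([ae_regular]).

    As [H2] is diagonal, bracketing a cubic functional with it multiplies the
    symmetrized coefficient of three letters by [i] times the signed sum of
    their frequencies ([sym3_poisson_H2], [sym3_fscale]).  At regular wave
    numbers this factor is nonzero.  Uniqueness follows by cancelling it, and
    dividing the coefficients of [H3NoRes] by it gives [K3]
    ([fscale_K3_reversal]).

    In the variables [(eta, xi)], the letters [z] and [zbar] differ by the sign
    of [i], so a product minus its conjugate keeps the monomials with an odd
    number of [xi], weighted by signed sums of reciprocals of the divisors
    ([to_etaxi_K3]).  Over the common denominator [heron] these sums become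
    the numerators of the coefficients P, Q and R ([partial_fractionP] and its
    companions).  The factor [k1 * k3 + |k1| * |k3|] of [Sker] vanishes when
    the signs of [k1] and [k3] differ, and otherwise turns [heron] into
    [dtilde] ([coupling_heron]).

    The kernel of [K3] is Borel because the neighborhood of the resonant curve
    is a countable union of compact sets: the curve does not reach the axes,
    where [dtilde < 0], so it is closed in the plane, and its tube is a
    continuous image of a closed set of triples (point, normal, parameter)
    ([measurable_Cplus_mu]). *)

(** * Dispersion relation and small divisors *)
Lemma omegaN (R : realType) (g D P k : R) : omega g D P (- k) = omega g D P k.
Proof. by rewrite /omega normrN; congr (Num.sqrt (_ * _)); ring. Qed.

Lemma dtildeC (R : realType) (g D P x y : R) :
  dtilde g D P x y = dtilde g D P y x.
Proof. by rewrite /dtilde; ring. Qed.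

(** All three pairs are required, although [K3] singles out [(k1, k3)]: the
    signs decide which pair controls the divisors, and the condition has to be
    stable under permutations of the slots. *)
Definition regular {R : realType} (P k1 k2 k3 : R) :=
  let dt := dtilde 1 1 P in
  [/\ k1 + k2 + k3 = 0, [/\ k1 != 0, k2 != 0 & k3 != 0] &
      [/\ dt k1 k2 != 0, dt k1 k3 != 0 & dt k2 k3 != 0]].

Section Dispersion.
Context {R : realType} {P : R} (P0 : 0 <= P) (P2 : P < 2).
Implicit Types x y k : R.

Local Notation dt := (dtilde 1 1 P).
Local Notation w := (omega 1 1 P).
Local Notation am := (a 1 1 P).

(** As a quadratic in [x ^+ 2] the symbol has discriminant [P ^+ 2 - 4]; this
    is where [P < 2] enters. *)
Lemma symbol_gt0 x : 0 < 1 - P * x ^+ 2 + 1 * x ^+ 4.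
Proof.
have -> : 1 - P * x ^+ 2 + 1 * x ^+ 4 =
  (x ^+ 2 - P / 2) ^+ 2 + (1 - P / 2) * (1 + P / 2) by field.
have h : 0 < (1 - P / 2) * (1 + P / 2).
  by have h0 := P0; have h2 := P2; apply: mulr_gt0; lra.
by have := sqr_ge0 (x ^+ 2 - P / 2); lra.
Qed.

Lemma omega_sqr k : w k ^+ 2 = `|k| * (1 - P * k ^+ 2 + 1 * k ^+ 4).
Proof. by rewrite sqr_sqrtr// mulr_ge0// ltW// symbol_gt0. Qed.

Lemma omega_gt0 k : k != 0 -> 0 < w k.
Proof. by move=> k0; rewrite sqrtr_gt0 mulr_gt0 ?normr_gt0// symbol_gt0. Qed.

Lemma a_gt0 k : k != 0 -> 0 < am k.
Proof. by move=> k0; rewrite sqrtr_gt0 divr_gt0 ?normr_gt0// omega_gt0. Qed.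

Lemma dtilde_axis x : dt x 0 < 0.
Proof. by rewrite /dtilde; have := symbol_gt0 x; lra. Qed.

(** Up to the factor -16, Heron's formula for the squared area of the triangle
    of sides [p], [q], [r]; its degeneracies are the three-wave resonances. *)
Definition heron (p q r : R) : R :=
  (p + q + r) * (p + q - r) * (p - q + r) * (p - q - r).

(** The linear terms of [omega k ^+ 2] are additive on wave numbers of the
    same sign, so [w2 ^+ 2 - w1 ^+ 2 - w3 ^+ 2] is divisible by [k1 * k3]; its
    square and [4 * w1 ^+ 2 * w3 ^+ 2] then share that factor. *)
Lemma heron_dtilde k1 k3 : 0 < k1 * k3 ->
  heron (w k1) (w (k1 + k3)) (w k3) = k1 * k3 * dt k1 k3.
Proof.
move=> k13.
have -> : heron (w k1) (w (k1 + k3)) (w k3) =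
   (w (k1 + k3) ^+ 2 - w k1 ^+ 2 - w k3 ^+ 2) ^+ 2
   - 4 * w k1 ^+ 2 * w k3 ^+ 2 by rewrite /heron; ring.
rewrite !omega_sqr /dtilde.
have [k1p|k1n|k10] := ltrgtP k1 0; last by rewrite k10 mul0r ltxx in k13.
  have k3n : k3 < 0 by rewrite -(nmulr_rgt0 _ k1p).
  by rewrite (ltr0_norm k1p) (ltr0_norm k3n) ltr0_norm; [ring|lra].
have k3p : 0 < k3 by rewrite -(pmulr_rgt0 _ k1n).
by rewrite (gtr0_norm k1n) (gtr0_norm k3p) gtr0_norm; [ring|lra].
Qed.

Lemma regular_rev k1 k2 k3 : regular P k1 k2 k3 -> regular P k3 k2 k1.
Proof.
move=> [s [h1 h2 h3] [d1 d2 d3]]; split; first by rewrite -s; ring.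
  by split.
by split; rewrite dtildeC.
Qed.

Lemma regular_swap k1 k2 k3 : regular P k1 k2 k3 -> regular P k2 k1 k3.
Proof.
move=> [s [h1 h2 h3] [d1 d2 d3]]; split; first by rewrite -s; ring.
  by split.
by split => //; rewrite dtildeC.
Qed.

(** The pair of equal sign varies, but [heron] is symmetric, so the case of
    the pair [(k1, k3)] covers the others. *)
Lemma heron_regular k1 k2 k3 : regular P k1 k2 k3 ->
  heron (w k1) (w k2) (w k3) != 0.
Proof.
have main x y : 0 < x * y -> dt x y != 0 ->
    heron (w x) (w (x + y)) (w y) != 0.
  move=> xy d; rewrite heron_dtilde// mulf_neq0//; exact: lt0r_neq0.
move=> [s [h1 h2 h3] [d1 d2 d3]].
have [k13|k13] := ltP 0 (k1 * k3).
  rewrite (_ : k2 = - (k1 + k3)) ?omegaN ?main//; lra.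
have {}k13 : k1 * k3 < 0 by rewrite lt_neqAle k13 mulf_neq0.
have [k12|k12] := ltP 0 (k1 * k2).
  rewrite (_ : k3 = - (k1 + k2)) ?omegaN; last by lra.
  have := main _ _ k12 d1; rewrite /heron; apply: contra_neq => <-; ring.
have {}k12 : k1 * k2 < 0 by rewrite lt_neqAle k12 mulf_neq0.
have k23 : 0 < k2 * k3.
  have : 0 < k1 * k3 * (k1 * k2) by rewrite nmulr_rgt0.
  rewrite (_ : _ * _ = k1 ^+ 2 * (k2 * k3)); last by ring.
  by rewrite pmulr_rgt0// exprn_even_gt0//.
rewrite (_ : k1 = - (k2 + k3)) ?omegaN; last by lra.
have := main _ _ k23 d3; rewrite /heron; apply: contra_neq => <-; ring.
Qed.

Lemma regular_denominators k1 k2 k3 : regular P k1 k2 k3 ->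
  [/\ w k1 + w k2 + w k3 != 0, w k1 + w k2 - w k3 != 0,
      w k1 - w k2 + w k3 != 0 & w k1 - w k2 - w k3 != 0].
Proof.
move/heron_regular; rewrite /heron !mulf_eq0 !negb_or.
by move=> /andP[/andP[/andP[]]].
Qed.
End Dispersion.

(** * Almost all wave numbers are regular *)
Lemma finite_roots (R : idomainType) (q : {poly R}) :
  q != 0 -> finite_set [set y | root q y].
Proof.
move=> q0; apply: contrapT => /(infinite_set_fset (size q)) [B Broot sB].
have : (size (finmap.enum_fset B) < size q)%N.
  apply: (max_poly_roots q0) (finmap.fset_uniq B).
  by apply/allP => y yB; exact: Broot.
by rewrite ltnNge sB.
Qed.

Section Generic.
Context {R : realType}.
Local Notation mu2 := (@lebesgue_measure R \x @lebesgue_measure R)%E.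

(** By Fubini: each vertical section of the zero set is the root set of a
    nonzero polynomial. *)
Lemma ae_poly_section_neq0 (f : R -> R -> R) :
    measurable_fun setT (fun p : R * R => f p.1 p.2) ->
    (forall x, exists q : {poly R}, forall y, f x y = q.[y]) ->
    (forall x, exists y, f x y != 0) ->
  {ae mu2, forall p : R * R, f p.1 p.2 != 0}.
Proof.
move=> mf fpoly fneq0; exists [set p : R * R | f p.1 p.2 = 0]; split.
- rewrite -[X in measurable X]setTI; exact: (mf measurableT [set 0]).
- rewrite /product_measure1 integral0_eq// => x _ /=.
  apply: countable_lebesgue_measure0; apply: finite_set_countable.
  have [q fq] := fpoly x; have [y0 fy0] := fneq0 x.
  have q0 : q != 0 by apply: contra_neq fy0 => q0; rewrite fq q0 horner0.
  apply: (sub_finite_set _ (finite_roots _ _ q0)) => y.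
  by rewrite /xsection/= inE /= fq => /rootP.
- by move=> p /= /negP; rewrite negbK => /eqP.
Qed.

#[global] Instance ae_product_filter : Filter (almost_everywhere mu2).
Proof. exact: (ae_filter_ringOfSetsType (mu2 : {measure set _ -> \bar R})). Qed.

Lemma ae_fst_neq0 : {ae mu2, forall p : R * R, p.1 != 0}.
Proof.
exists ([set 0] `*` setT); split.
- exact: measurableX.
- by rewrite product_measure1E// [X in (X * _)%E]lebesgue_measure_set1 mul0e.
- by move=> p /= /negP; rewrite negbK => /eqP.
Qed.

End Generic.

Ltac measurability :=
  repeat first
    [ exact: measurable_cst | exact: measurable_fst | exact: measurable_snd
    | apply: measurable_funX
    | apply: measurable_funB | apply: measurable_funM | apply: measurable_funD
    | apply: measurable_funN ].

(** [dtilde] with polynomial arguments, so that its sections along lines are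
    visibly polynomial and can be differentiated formally. *)
Definition dtilde_poly {R : realType} (P : R) (u v : {poly R}) : {poly R} :=
  u * v * (u + v) ^+ 2
    * ((3 * P)%:P - 5%:P * (u ^+ 2 + u * v + v ^+ 2)) ^+ 2
  - 4%:P * (1 - P%:P * u ^+ 2 + u ^+ 4) * (1 - P%:P * v ^+ 2 + v ^+ 4).

Section Regular.
Context {R : realType} {P : R} (P0 : 0 <= P) (P2 : P < 2).
Local Notation mu2 := (@lebesgue_measure R \x @lebesgue_measure R)%E.

Local Notation dt := (dtilde 1 1 P).

Lemma horner_dtilde_poly (u v : {poly R}) y :
  (dtilde_poly P u v).[y] = dt u.[y] v.[y].
Proof.
by rewrite /dtilde /dtilde_poly !(hornerE, horner_exp, hornerMn).
Qed.

Lemma measurable_dtilde d (T : measurableType d) (f h : T -> R) :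
  measurable_fun setT f -> measurable_fun setT h ->
  measurable_fun setT (fun t => dt (f t) (h t)).
Proof. by move=> mf mh; rewrite /dtilde; measurability. Qed.

(** For fixed [k1 = x], each of the three values of [dtilde] is polynomial in
    [k3] and reduces to [dtilde] on an axis at a suitable [k3]. *)
Lemma ae_regular : {ae mu2, forall p : R * R, 
  regular P p.1 (- p.1 - p.2) p.2}.
Proof.
have e3 : {ae mu2, forall p : R * R, p.2 != 0}.
  apply: (ae_poly_section_neq0 (fun _ y => y)); first exact: measurable_snd.
    by move=> _; exists 'X => y; rewrite hornerX.
  by move=> _; exists 1; exact: oner_neq0.
have e2 : {ae mu2, forall p : R * R, - p.1 - p.2 != 0}.
  apply: (ae_poly_section_neq0 (fun x y => - x - y)).
  - by measurability.
  - by move=> x; exists ((- x)%:P - 'X) => y; rewrite !hornerE.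
  - by move=> x; exists (- x - 1); rewrite opprB addrC subrK oner_neq0.
have e12 : {ae mu2, forall p : R * R, dt p.1 (- p.1 - p.2) != 0}.
  apply: (ae_poly_section_neq0 (fun x y => dt x (- x - y))).
  - by apply: measurable_dtilde; measurability.
  - move=> x; exists (dtilde_poly P x%:P ((- x)%:P - 'X)) => y.
    by rewrite horner_dtilde_poly !hornerE.
  - by move=> x; exists (- x); rewrite subrr ltr0_neq0// dtilde_axis.
have e13 : {ae mu2, forall p : R * R, dt p.1 p.2 != 0}.
  apply: (ae_poly_section_neq0 (fun x y => dt x y)).
  - by apply: measurable_dtilde; measurability.
  - move=> x; exists (dtilde_poly P x%:P 'X) => y.
    by rewrite horner_dtilde_poly !hornerE.
  - by move=> x; exists 0; rewrite ltr0_neq0// dtilde_axis.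
have e23 : {ae mu2, forall p : R * R, dt (- p.1 - p.2) p.2 != 0}.
  apply: (ae_poly_section_neq0 (fun x y => dt (- x - y) y)).
  - by apply: measurable_dtilde; measurability.
  - move=> x; exists (dtilde_poly P ((- x)%:P - 'X) 'X) => y.
    by rewrite horner_dtilde_poly !hornerE.
  - by move=> x; exists 0; rewrite subr0 ltr0_neq0// dtilde_axis.
near=> p; split; [by ring|split|split]; near: p => //; exact: ae_fst_neq0.
Unshelve. all: by end_near. Qed.
End Regular.

Section Calculus.
Context {R : realType}.
Local Notation C := R[i].

(** * The bracket with the quadratic Hamiltonian *)
Lemma fderiv_homogeneous {L : Type} n (F : functional R L) x w :
  homogeneous n.+1 F -> size w != n -> fderiv x F w = 0.
Proof.
move=> F3 wn; rewrite /fderiv big1// => i _; apply: F3.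
by rewrite size_cat/= addnS -size_cat cat_take_drop eqSS.
Qed.

(** The sign is that of the rotation of the letter under the flow of [H2]:
    [z] and [zbar] turn in opposite directions. *)
Definition frequency g D P (x : zvar * R) : R :=
  if x.1 is Z then omega g D P x.2 else - omega g D P x.2.

(** With [f := frequency] this multiplier has the same symmetrization as the
    bracket with [H2], which itself acts on the first letter of each word
    only. *)
Definition fscale {L : Type} (f : L * R -> R) (F : functional R L) :
  functional R L := fun w => 'i%C * (\sum_(x <- w) f x)%:C * F w.

Lemma i_neq0 : ('i%C : C) != 0.
Proof.
apply: contra_eq_neq (sqr_i R) => ->.
by rewrite expr0n/= eq_sym oppr_eq0 oner_neq0.
Qed.

Lemma invi : ('i%C : C)^-1 = - 'i%C.
Proof.
by apply: (mulfI i_neq0); rewrite divff ?i_neq0// mulrN -expr2 sqr_i opprK.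
Qed.

Lemma real_complex_eq0 (x : R) : (x%:C == 0 :> C) = (x == 0).
Proof. exact: fmorph_eq0. Qed.

(** Only the splitting after the first letter contributes: [H2] is quadratic,
    so its derivative takes one letter, and the derivative of the cubic [K]
    takes the other two. *)
Lemma poisson_H2_word g D P (K : functional R zvar) x y t :
  homogeneous 3 K ->
  poisson K (H2 g D P) [:: x; y; t] =
  'i%C * (frequency g D P x)%:C *
    (K [:: x; y; t] + K [:: y; x; t] + K [:: y; t; x]).
Proof.
move=> K3h; rewrite /poisson /= !big_ord_recl big_ord0 /=.
have Kw u v : size v != 2 -> fderiv u K v = 0.
  exact: fderiv_homogeneous.
rewrite !(Kw _ [:: x; y; t])// !(Kw _ [:: t])// !(Kw _ [::])//.
rewrite !(mulr0, subrr, add0r, addr0, subr0) /fderiv /= /momentum.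
rewrite !(big_cons, big_nil, big_ord_recl, big_ord0) /= !addr0 opprK invi.
by case: x => [[] k]; rewrite /frequency /= ?omegaN; ring.
Qed.

Lemma sym3_poisson_H2 g D P (K : functional R zvar) x y t :
  homogeneous 3 K ->
  sym3 (poisson K (H2 g D P)) x y t =
  sym3 (fscale (frequency g D P) K) x y t.
Proof.
move=> K3h; rewrite /sym3 !poisson_H2_word// /fscale !big_cons !big_nil /=.
ring.
Qed.

Lemma sym3_fscale {L : Type} (f : L * R -> R) (F : functional R L) x y t :
  sym3 (fscale f F) x y t = 'i%C * (f x + f y + f t)%:C * sym3 F x y t.
Proof. by rewrite /sym3 /fscale !big_cons !big_nil /=; ring. Qed.

(** The coefficients of [H3] and [K3] are symmetric in the outer slots 1 and 3
    but not in the middle one.  The six permutations are therefore grouped in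
    three pairs, one for each letter in the middle. *)
Lemma eq_cubic_reversal P {L : Type} (F G : functional R L) :
  0 <= P -> P < 2 ->
  (forall l1 l2 l3 k1 k2 k3, regular P k1 k2 k3 ->
     F [:: (l1, k1); (l2, k2); (l3, k3)] + F [:: (l3, k3); (l2, k2); (l1, k1)] =
     G [:: (l1, k1); (l2, k2); (l3, k3)] + G [:: (l3, k3); (l2, k2); (l1, k1)])
  -> eq_cubic F G.
Proof.
move=> P0 P2 FG; have aer := ae_regular P0 P2.
rewrite /eq_cubic; near=> p => l1 l2 l3.
have r : regular P p.1 (- p.1 - p.2) p.2 by near: p.
move: (p.1) (- p.1 - p.2) (p.2) r => k1 k2 k3 r.
have sum3 (H : functional R L) x y t : sym3 H x y t =
    (H [:: x; y; t] + H [:: t; y; x]) + (H [:: y; x; t] + H [:: t; x; y])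
    + (H [:: x; t; y] + H [:: y; t; x]) by rewrite /sym3; ring.
rewrite !sum3 !FG//; last by exact: regular_swap.
by apply/regular_swap/regular_rev/regular_swap.
Unshelve. all: by end_near. Qed.

Lemma SkerC g D P (k1 k2 k3 : R) : Sker g D P k3 k2 k1 = Sker g D P k1 k2 k3.
Proof. by rewrite /Sker; ring. Qed.

Lemma CplusC g D P (p : R * R) : Cplus g D P p -> Cplus g D P (p.2, p.1).
Proof. by case=> p1 p2 dp; split => //=; rewrite dtildeC. Qed.

(** The reflection in the diagonal preserves [dtilde], so it exchanges the two
    components of its gradient, and maps the neighborhood of the resonant curve
    to itself. *)
Lemma unit_normalC g D P (p n : R * R) :
  unit_normal g D P p n -> unit_normal g D P (p.2, p.1) (n.2, n.1).
Proof.
move=> [n1 nd]; split => /=; first by rewrite addrC.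
by under eq_fun do rewrite dtildeC; under [in RHS]eq_fun do rewrite dtildeC.
Qed.

Lemma Cplus_muC g D P mu (q : R * R) :
  Cplus_mu g D P mu q -> Cplus_mu g D P mu (q.2, q.1).
Proof.
move=> [q1 q2 [p [n [t [cp np t1 qE]]]]]; split => //.
exists (p.2, p.1), (n.2, n.1), t; split => //.
- exact: CplusC.
- exact: unit_normalC.
- by rewrite qE.
Qed.

Lemma N_muC g D P mu (k1 k2 k3 : R) :
  N_mu g D P mu (k1, k2, k3) -> N_mu g D P mu (k3, k2, k1).
Proof.
move=> [q qC [-> -> ->]]; exists (q.2, q.1); last first.
  by congr (_, _, _) => /=; ring.
by case: qC => h; [left|right]; exact: (Cplus_muC _ _ _ _ _ h).
Qed.

Lemma chiC g D P mu (k1 k2 k3 : R) :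
  chi g D P mu k3 k2 k1 = chi g D P mu k1 k2 k3.
Proof.
rewrite /chi !indicE; congr (_%:R); congr nat_of_bool.
by apply/idP/idP; rewrite !inE; exact: N_muC.
Qed.

End Calculus.

(** * The cohomological equation *)
Section Cohomological.
Context {R : realType} {P : R} (P0 : 0 <= P) (P2 : P < 2) (mu : R).

(** In the pattern (z, z, zbar) the coefficient of [K3] carries a 2 and its
    mirror (zbar, z, z) does not occur, while in [H3] both occur with
    coefficient 1; that is why a word and its reversal are added. *)
Lemma fscale_K3_reversal l1 l2 l3 k1 k2 k3 : regular P k1 k2 k3 ->
  let G := fscale (frequency 1 1 P) (K3 1 1 P mu) in
  let F := H3NoRes 1 1 P mu in
  G [:: (l1, k1); (l2, k2); (l3, k3)] + G [:: (l3, k3); (l2, k2); (l1, k1)] =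
  F [:: (l1, k1); (l2, k2); (l3, k3)] + F [:: (l3, k3); (l2, k2); (l1, k1)].
Proof.
move=> r G F; rewrite {}/G {}/F.
rewrite /fscale /H3NoRes /fadd /fopp /K3 /H3 /H3Res /cubic_int.
rewrite !big_cons !big_nil /frequency /=.
rewrite (SkerC _ _ _ k1) (chiC _ _ _ _ k1).
move: (Sker _ _ _ _ _ _) (chi _ _ _ _ _ _ _) => S X.
have [] := regular_denominators P0 P2 _ _ _ r.
move: (omega _ _ _ k1) (omega _ _ _ k2) (omega _ _ _ k3) =>
  w1 w2 w3 d0 d3 d2 d1.
rewrite !fmorphV.
have := @i_neq0 R; move: ('i%C) => i i0.
have q0 : (Num.sqrt pi : R) != 0 by rewrite gt_eqF// sqrtr_gt0 pi_gt0.
move: (Num.sqrt pi) q0 => q q0.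
have [r0 r3 r2] : [/\ w3 + w2 + w1 != 0, w3 + w2 - w1 != 0 &
    w3 - w2 + w1 != 0].
  split; [move: d0|move: d1|move: d2]; apply: contra_neq => h.
  - by rewrite -h; ring.
  - by rewrite -oppr0 -h; ring.
  - by rewrite -h; ring.
case: l1; case: l2; case: l3; rewrite /z /zb /=; field;
  by rewrite /= -?(rmorphD, rmorphB) ?real_complex_eq0 ?i0 ?q0 ?r0 ?r2 ?r3
             ?d0 ?d2 ?d3.
Qed.

End Cohomological.

Lemma homogeneous_cubic_int {R : realType} {L : Type}
    (f : R -> R -> R -> L -> L -> L -> R[i]) : homogeneous 3 (cubic_int f).
Proof. by case=> [|[? ?] [|[? ?] [|[? ?] []]]]. Qed.

Section Solution.
Context {R : realType} {P : R} (P0 : 0 <= P) (P2 : P < 2) (mu : R).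
Local Notation freq := (frequency 1 1 P).

Lemma frequency_regular l1 l2 l3 k1 k2 k3 : regular P k1 k2 k3 ->
  freq (l1, k1) + freq (l2, k2) + freq (l3, k3) != 0.
Proof.
move=> /(regular_denominators P0 P2) [d0 d3 d2 d1].
case: l1; case: l2; case: l3; rewrite /frequency /=;
  [move: d0|move: d3|move: d2|move: d1|move: d1|move: d2|move: d3|move: d0];
  apply: contra_neq => h; try exact: h; by rewrite -oppr0 -h; ring.
Qed.

Lemma K3_solution :
  eq_cubic (poisson (K3 1 1 P mu) (H2 1 1 P)) (H3NoRes 1 1 P mu).
Proof.
have : eq_cubic (fscale freq (K3 1 1 P mu)) (H3NoRes 1 1 P mu).
  by apply: eq_cubic_reversal P0 P2 _; exact: fscale_K3_reversal.
apply: filterS => p + l1 l2 l3.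
by rewrite sym3_poisson_H2//; exact: homogeneous_cubic_int.
Qed.

Lemma K3_unique (K : functional R zvar) : cubic_functional K ->
  eq_cubic (poisson K (H2 1 1 P)) (H3NoRes 1 1 P mu) ->
  eq_cubic K (K3 1 1 P mu).
Proof.
move=> [K3h _] Keq; have K3eq := K3_solution; have aer := ae_regular P0 P2.
apply: filterS3 Keq K3eq aer => p pK pK3 r l1 l2 l3.
move: (pK l1 l2 l3); rewrite -(pK3 l1 l2 l3).
rewrite !sym3_poisson_H2//; last exact: homogeneous_cubic_int.
rewrite !sym3_fscale; apply: mulfI.
by rewrite mulf_neq0 ?i_neq0// real_complex_eq0 frequency_regular.
Qed.

Local Notation om := (omega 1 1 P).
Local Notation am := (a 1 1 P).

(** * Passage to the physical variables *)
Definition amplitude (y : pvar) (k : R) : R :=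
  if y is Eta then am k else (am k)^-1.

Definition phase (x : zvar) (y : pvar) : R[i] :=
  match x, y with
  | _, Eta => 1
  | Z, Xi => 'i%C
  | Zbar, Xi => - 'i%C
  end.

Lemma zcoordE x k y : zcoord 1 1 P x k y =
  (Num.sqrt 2)^-1%:C * (amplitude y k)%:C * phase x y.
Proof.
by case: x; case: y; rewrite /zcoord /amplitude /eta /xi /=; ring.
Qed.

(** The imaginary parts of the three products of phases in [K3], each weighted
    by its coefficient over its divisor; they vanish for an even number of
    [Xi]. *)
Definition etaxi_bracket (k1 k2 k3 : R) (y1 y2 y3 : pvar) : R :=
  let d0 := (om k1 + om k2 + om k3)^-1 in
  let d3 := (om k1 + om k2 - om k3)^-1 in
  let d2 := (1 - chi 1 1 P mu k1 k2 k3) * (om k1 - om k2 + om k3)^-1 in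
  match y1, y2, y3 with
  | Eta, Eta, Xi => d0 + 2 * d3 + d2
  | Xi, Eta, Eta => d0 - 2 * d3 + d2
  | Eta, Xi, Eta => d0 - 2 * d3 - d2
  | Xi, Xi, Xi => - d0 - 2 * d3 + d2
  | _, _, _ => 0
  end.

Lemma to_etaxi_K3 k1 k2 k3 y1 y2 y3 :
  to_etaxi 1 1 P (K3 1 1 P mu) [:: (y1, k1); (y2, k2); (y3, k3)] =
  ((8 * Num.sqrt (2 * pi))^-1 * Sker 1 1 P k1 k2 k3 *
   (amplitude y1 k1 * amplitude y2 k2 * amplitude y3 k3) *
   etaxi_bracket k1 k2 k3 y1 y2 y3)%:C.
Proof.
rewrite /to_etaxi /= !zcoordE /K3 /= /etaxi_bracket sqrtrM// -!fmorphV.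
move: (Sker _ _ _ _ _ _) (chi _ _ _ _ _ _ _) => S X.
move: (amplitude y1 k1) (amplitude y2 k2) (amplitude y3 k3) => a1 a2 a3.
move: (om k1 + _ + _)^-1 (om k1 + _ - _)^-1 (om k1 - _ + _)^-1 => d0 d3 d2.
have e2 : 2 * (Num.sqrt 2 : R)^-1 ^+ 2 = 1.
  by rewrite exprVn sqr_sqrtr// divff.
rewrite !invfM invi.
move: (Num.sqrt 2)^-1 e2 => e e2.
have {}e2 : 2 * e%:C ^+ 2 = 1 :> R[i].
  by rewrite -rmorphXn -(rmorph_nat (real_complex R)) -rmorphM e2.
rewrite -!fmorphV !invfM; move: (Num.sqrt pi)^-1 => q.
move: (sqr_i R); rewrite /phase /z /zb; move: ('i%C) => i i2.
(* Both units below are 1; they supply the powers of 'i and of 1 / sqrt 2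
   that occur with one Xi and with three Xi respectively. *)
have c1 r : - i ^+ 2 * (2 * e%:C ^+ 2) * r = r by rewrite e2 i2; ring.
have c3 r : i ^+ 4 * (2 * e%:C ^+ 2) * r = r.
  by rewrite e2 (exprM i 2 2) i2; ring.
by case: y1; case: y2; case: y3; rewrite /=;
  solve [ring | rewrite -[RHS]c1; ring | rewrite -[RHS]c3; ring].
Qed.

(** When the signs of [k1] and [k3] differ both sides are 0; when they agree,
    the numerators are [2 * k1 * k3] and 2, and [heron_dtilde] applies. *)
Lemma coupling_heron k1 k2 k3 : regular P k1 k2 k3 ->
  (k1 * k3 + `|k1| * `|k3|) / heron (om k1) (om k2) (om k3) =
  (1 + Num.sg k1 * Num.sg k3) / dtilde 1 1 P k1 k3.
Proof.
move=> [s [h1 h2 h3] [_ d13 _]].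
have [k13|k13] := ltP 0 (k1 * k3); last first.
  have sg13 : Num.sg k1 * Num.sg k3 = -1.
    by rewrite -sgrM ltr0_sg// lt_neqAle k13 mulf_neq0.
  by rewrite sg13 subrr mul0r -normrM ler0_norm// subrr mul0r.
have -> : k2 = - (k1 + k3) by apply/eqP; rewrite -subr_eq0 -s; apply/eqP; ring.
rewrite omegaN heron_dtilde// -normrM gtr0_norm// -sgrM gtr0_sg//.
by field; rewrite d13 h1 h3.
Qed.

(** Each bracket plus its mirror image under the exchange of 1 and 3.  The term
    in [X] comes from [Pi / heron], which is the reciprocal of the divisor
    [w1 - w2 + w3] of the removed resonant part. *)
Section PartialFractions.
Variables (w1 w2 w3 X : R).
Hypotheses (h0 : w1 + w2 + w3 != 0) (h3 : w1 + w2 - w3 != 0)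
  (h2 : w1 - w2 + w3 != 0) (h1 : w1 - w2 - w3 != 0).
Let h1' : w3 + w2 - w1 != 0.
Proof. by move: h1; apply: contra_neq => h; rewrite -oppr0 -h; ring. Qed.
Let h0' : w3 + w2 + w1 != 0.
Proof. by move: h0; apply: contra_neq => h; rewrite -h; ring. Qed.
Let h2' : w3 - w2 + w1 != 0.
Proof. by move: h2; apply: contra_neq => h; rewrite -h; ring. Qed.

Let Pi := (w1 + w2 + w3) * (w1 + w2 - w3) * (w1 - w2 - w3).

Lemma partial_fractionP :
  ((w1 + w2 + w3)^-1 + 2 * (w1 + w2 - w3)^-1 + (1 - X) * (w1 - w2 + w3)^-1) +
  ((w3 + w2 + w1)^-1 - 2 * (w3 + w2 - w1)^-1 + (1 - X) * (w3 - w2 + w1)^-1) =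
  2 * (4 * w1 * (w1 ^+ 2 - w2 ^+ 2 - w3 ^+ 2) - X * Pi) / heron w1 w2 w3.
Proof.
by rewrite /heron /Pi; field; rewrite h0 h1 ?h2 h3 ?h0' h1' ?h2'.
Qed.

Lemma partial_fractionQ :
  ((w1 + w2 + w3)^-1 - 2 * (w1 + w2 - w3)^-1 - (1 - X) * (w1 - w2 + w3)^-1) +
  ((w3 + w2 + w1)^-1 - 2 * (w3 + w2 - w1)^-1 - (1 - X) * (w3 - w2 + w1)^-1) =
  2 * (8 * w1 * w2 * w3 + X * Pi) / heron w1 w2 w3.
Proof.
by rewrite /heron /Pi; field; rewrite h0 h1 ?h2 h3 ?h0' h1' ?h2'.
Qed.

Lemma partial_fractionR :
  (- (w1 + w2 + w3)^-1 - 2 * (w1 + w2 - w3)^-1 + (1 - X) * (w1 - w2 + w3)^-1) +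
  (- (w3 + w2 + w1)^-1 - 2 * (w3 + w2 - w1)^-1 + (1 - X) * (w3 - w2 + w1)^-1) =
  2 * (4 * w2 * (w1 ^+ 2 - w2 ^+ 2 + w3 ^+ 2) - X * Pi) / heron w1 w2 w3.
Proof.
by rewrite /heron /Pi; field; rewrite h0 h1 ?h2 h3 ?h0' h1' ?h2'.
Qed.
End PartialFractions.

Definition etaxi_coef (k1 k2 k3 : R) (y1 y2 y3 : pvar) : R :=
  match y1, y2, y3 with
  | Eta, Eta, Xi => coefP 1 1 P mu k1 k2 k3
  | Eta, Xi, Eta => coefQ 1 1 P mu k1 k2 k3
  | Xi, Xi, Xi => coefR 1 1 P mu k1 k2 k3
  | _, _, _ => 0
  end.

Lemma K3etaxiE k1 k2 k3 y1 y2 y3 :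
  K3etaxi 1 1 P mu [:: (y1, k1); (y2, k2); (y3, k3)] =
  ((Num.sqrt (2 * pi))^-1 * etaxi_coef k1 k2 k3 y1 y2 y3)%:C.
Proof.
by rewrite /K3etaxi /= /eta /xi; case: y1; case: y2; case: y3 => /=; ring.
Qed.

Lemma etaxi_bracket_coef k1 k2 k3 y1 y2 y3 : regular P k1 k2 k3 ->
  Sker 1 1 P k1 k2 k3 * (amplitude y1 k1 * amplitude y2 k2 * amplitude y3 k3)
    * (etaxi_bracket k1 k2 k3 y1 y2 y3 + etaxi_bracket k3 k2 k1 y3 y2 y1) =
  8 * (etaxi_coef k1 k2 k3 y1 y2 y3 + etaxi_coef k3 k2 k1 y3 y2 y1).
Proof.
move=> r.
(* The case (Xi, Eta, Eta) is the mirror image of (Eta, Eta, Xi). *)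
wlog side : y1 y3 k1 k3 r / ~ [/\ y1 = Xi, y2 = Eta & y3 = Eta].
  move=> main.
  have [[y1E y2E y3E]|] := pselect [/\ y1 = Xi, y2 = Eta & y3 = Eta].
    rewrite [in RHS]addrC -main; last 2 first.
    - exact: regular_rev.
    - by rewrite y1E y3E => -[].
    by rewrite SkerC; ring.
  exact: main.
have [h0 h3 h2 h1] := regular_denominators P0 P2 _ _ _ r.
have := coupling_heron _ _ _ r; have := heron_regular P0 P2 _ _ _ r.
have [s [n1 n2 n3] [_ d13 _]] := r.
have a1 := lt0r_neq0 (a_gt0 P0 P2 _ n1).
have a2 := lt0r_neq0 (a_gt0 P0 P2 _ n2).
have a3 := lt0r_neq0 (a_gt0 P0 P2 _ n3).
rewrite /etaxi_bracket /etaxi_coef /coefP /coefQ /coefR /Pi3 /amplitude /Sker.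
rewrite (chiC _ _ _ _ k1).
rewrite (dtildeC _ _ _ _ k3) [Num.sg k3 * _]mulrC.
move: (chi _ _ _ _ _ _ _) => X.
move: (k1 * k3 + _) (1 + _) => S G.
move: (am k1) (am k2) (am k3) a1 a2 a3 => A1 A2 A3 a1 a2 a3.
move: (om k1) (om k2) (om k3) h0 h1 h2 h3 => w1 w2 w3 h0 h1 h2 h3.
move: (dtilde _ _ _ _ _) d13 => d d13 H0 SG.
have -> : S = G / d * heron w1 w2 w3 by rewrite -SG divfK.
case: y1 side; case: y2; case: y3 => // side;
  rewrite ?partial_fractionP ?partial_fractionQ ?partial_fractionR//;
  move: (heron _ _ _) H0 => H H0;
  try by field; rewrite ?H0 ?d13 ?a1 ?a2 ?a3.
by case: side.
Qed.

Lemma to_etaxi_K3_eq :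
  eq_cubic (to_etaxi 1 1 P (K3 1 1 P mu)) (K3etaxi 1 1 P mu).
Proof.
apply: eq_cubic_reversal P0 P2 _ => y1 y2 y3 k1 k2 k3 r.
have := etaxi_bracket_coef _ _ _ y1 y2 y3 r.
rewrite !to_etaxi_K3 !K3etaxiE (SkerC _ _ _ k1) invfM.
rewrite -!rmorphD => e; congr (_%:C); rewrite -mulrDr.
have eight : 8 != 0 :> R by [].
by rewrite -[X in _ = _ * X](mulKf eight) -e; ring.
Qed.

End Solution.

(** * Measurability of the resonant neighborhood *)
Section Plane.
Context {R : realType}.

(** An open set of the plane is the union of the squares of rational centre and
    radius [1 / n.+1] that it contains. *)
Lemma open_plane_measurable (U : set (R * R)) : open U -> measurable U.
Proof.
move=> oU.
pose r n : R := n.+1%:R^-1.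
pose box (q s : rat) n := ball (ratr q : R) (r n) `*` ball (ratr s : R) (r n).
have mbox q s n : measurable (box q s n).
  by apply: measurableX; exact: measurable_ball.
rewrite (_ : U = \bigcup_q \bigcup_s \bigcup_n
    (if pselect (box q s n `<=` U) then box q s n else set0)); last first.
  apply/seteqP; split=> [p Up|p [q _ [s _ [n _]]]]; last first.
    by case: pselect => // h; exact: h.
  have /nbhs_ballP[e /= e0 pU] : nbhs p U by exact: open_nbhs_nbhs.
  have e20 : 0 < e / 2 by rewrite divr_gt0.
  have [n nlt] : exists n, r n < e / 2.
    by have [n] := ltr_add_invr e20; rewrite add0r; exists n.
  have r0 : 0 < r n by rewrite invr_gt0 ltr0n.
  have near_rat (x : R) : exists q : rat, ball (ratr q : R) (r n) x.
    have [|q] := @rat_in_itvoo R (x - r n) (x + r n); first by lra.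
    rewrite in_itv/= => /andP[q1 q2]; exists q.
    by rewrite /ball/= ltr_norml; apply/andP; split; lra.
  have [q pq] := near_rat p.1; have [s ps] := near_rat p.2.
  have boxU : box q s n `<=` U.
    have tri (x y z : R) : ball z (r n) x -> ball z (r n) y -> ball x e y.
      move=> zx zy; have : ball x (r n + r n) y.
        by apply: ball_triangle zy; exact: ball_sym.
      by apply: le_ball; lra.
    by move=> t [tq ts]; apply: pU; split; [exact: tri pq tq|exact: tri ps ts].
  by exists q => //; exists s => //; exists n => //; case: pselect.
apply: bigcupT_measurable_rat => q; apply: bigcupT_measurable_rat => s.
apply: bigcupT_measurable => n.
by case: pselect => ?; [exact: mbox|exact: measurable0].
Qed.

Lemma closed_plane_measurable (A : set (R * R)) : closed A -> measurable A.
Proof.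
by move/closed_openC/open_plane_measurable/measurableC; rewrite setCK.
Qed.

Lemma measurable_invr : measurable_fun [set: R] (@GRing.inv R).
Proof.
rewrite (_ : setT = [set 0] `|` ~` [set 0]); last by rewrite setUv.
apply/measurable_funU => //; first exact: measurableC.
split; first exact: measurable_fun_set1.
apply: open_continuous_measurable_fun; first exact: closed_openC.
by move=> x /=; rewrite inE/= => /eqP x0; exact: inv_continuous.
Qed.

Lemma measurable_sqrt : measurable_fun [set: R] (@Num.sqrt R).
Proof. by apply: continuous_measurable_fun; exact: sqrt_continuous. Qed.

End Plane.

Section Curve.
Context {R : realType} {P : R} (P0 : 0 <= P) (P2 : P < 2) (mu : R).
Local Notation dt := (dtilde 1 1 P).

Lemma derive1_dtilde x y : derive1 (fun y => dt x y) y =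
  x * (x + y) ^+ 2 * (3 * P - 5 * (x ^+ 2 + x * y + y ^+ 2)) ^+ 2
  + 2 * x * y * (x + y) * (3 * P - 5 * (x ^+ 2 + x * y + y ^+ 2)) ^+ 2
  - 10 * x * y * (x + y) ^+ 2 * (x + 2 * y)
    * (3 * P - 5 * (x ^+ 2 + x * y + y ^+ 2))
  - 4 * (1 - P * x ^+ 2 + x ^+ 4) * (4 * y ^+ 3 - 2 * P * y).
Proof.
have -> : (fun y => dt x y) = horner (dtilde_poly P x%:P 'X).
  by apply/funext => t; rewrite horner_dtilde_poly !hornerE.
rewrite -derivE /dtilde_poly !expr2 !exprS !expr0 !poly.derivE.
rewrite !(hornerD, hornerN, hornerM, hornerC, hornerX).
ring.
Qed.

Lemma closed_eq_continuous (T : topologicalType) (f h : T -> R) :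
  continuous f -> continuous h -> closed [set t | f t = h t].
Proof.
move=> cf ch.
have -> : [set t | f t = h t] = (fun t => f t - h t) @^-1` [set 0].
  by apply/seteqP; split=> t /= => [->|/eqP]; rewrite ?subrr// subr_eq0 => /eqP.
apply: closed_comp; last exact: closed_eq.
by move=> t _; apply: continuousB; [exact: cf|exact: ch].
Qed.

Lemma continuous_fst_comp (T U V : topologicalType) (f : T -> U * V) :
  continuous f -> continuous (fun t => (f t).1).
Proof.
move=> cf t; apply: (@continuous_comp _ _ _ f fst); first exact: cf.
exact: cvg_fst.
Qed.

Lemma continuous_snd_comp (T U V : topologicalType) (f : T -> U * V) :
  continuous f -> continuous (fun t => (f t).2).
Proof.
move=> cf t; apply: (@continuous_comp _ _ _ f snd); first exact: cf.
exact: cvg_snd.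
Qed.

Lemma continuous_exprn (T : topologicalType) (f : T -> R) n :
  continuous f -> continuous (fun t => f t ^+ n).
Proof.
move=> cf t; apply: (@continuous_comp _ _ _ f (fun x => x ^+ n)).
  exact: cf.
exact: exprn_continuous.
Qed.

Lemma continuous_sum (T : topologicalType) (f h : T -> R) :
  continuous f -> continuous h -> continuous (fun t => f t + h t).
Proof. by move=> cf ch t; apply: continuousD; [exact: cf|exact: ch]. Qed.

Lemma continuous_diff (T : topologicalType) (f h : T -> R) :
  continuous f -> continuous h -> continuous (fun t => f t - h t).
Proof. by move=> cf ch t; apply: continuousB; [exact: cf|exact: ch]. Qed.

Lemma continuous_prod (T : topologicalType) (f h : T -> R) :
  continuous f -> continuous h -> continuous (fun t => f t * h t).
Proof. by move=> cf ch t; apply: continuousM; [exact: cf|exact: ch]. Qed.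

Ltac continuity :=
  lazymatch goal with
  | |- continuous (fun t => @?f t + - @?h t) =>
      apply: (continuous_diff _ f h); continuity
  | |- continuous (fun t => @?f t + @?h t) =>
      apply: (continuous_sum _ f h); continuity
  | |- continuous (fun t => @?f t * @?h t) =>
      apply: (continuous_prod _ f h); continuity
  | |- continuous (fun t => @?f t ^+ ?n) =>
      apply: (continuous_exprn _ f n); continuity
  | |- continuous (fun t => (@?f t).1) =>
      apply: (continuous_fst_comp _ _ _ f); continuity
  | |- continuous (fun t => (@?f t).2) =>
      apply: (continuous_snd_comp _ _ _ f); continuity
  | |- continuous (fun t => t) => move=> ?; exact: cvg_id
  | |- continuous (fun _ => ?c) => exact: cst_continuous
  | |- _ => assumption
  end.

Lemma continuous_dtilde (T : topologicalType) (f h : T -> R) :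
  continuous f -> continuous h -> continuous (fun t => dt (f t) (h t)).
Proof. by move=> cf ch; rewrite /dtilde; continuity. Qed.

Lemma continuous_derive1_dtilde (T : topologicalType) (f h : T -> R) :
  continuous f -> continuous h ->
  continuous (fun t => derive1 (fun y => dt (f t) y) (h t)).
Proof.
move=> cf ch; rewrite (funext (fun t => derive1_dtilde (f t) (h t))).
by continuity.
Qed.

Lemma derive1_dtildel x y :
  derive1 (fun x => dt x y) x = derive1 (fun x => dt y x) x.
Proof. by congr (derive1 _ x); apply/funext => t; exact: dtildeC. Qed.

(** The strict inequalities may be relaxed because [dtilde < 0] on the axes;
    this makes the curve closed. *)
Lemma CplusE : Cplus 1 1 P = [set p | [/\ 0 <= p.1, 0 <= p.2 & dt p.1 p.2 = 0]].
Proof.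
apply/seteqP; split=> p [p1 p2 dp]; split=> //; try exact: ltW.
- rewrite lt_neqAle p1 andbT; apply: contraTneq (dtilde_axis P0 P2 p.2).
  by move=> p10; move: dp; rewrite -p10 dtildeC => ->; rewrite ltxx.
- rewrite lt_neqAle p2 andbT; apply: contraTneq (dtilde_axis P0 P2 p.1).
  by move=> p20; move: dp; rewrite -p20 => ->; rewrite ltxx.
Qed.

(* A parameter is ((point, normal), position along the normal). *)
Local Notation param := ((R * R) * (R * R) * R)%type.
Let p1 (s : param) := s.1.1.1.
Let p2 (s : param) := s.1.1.2.
Let n1 (s : param) := s.1.2.1.
Let n2 (s : param) := s.1.2.2.
Let tt (s : param) := s.2.
Let cp1 : continuous p1. Proof. by rewrite /p1; continuity. Qed.
Let cp2 : continuous p2. Proof. by rewrite /p2; continuity. Qed.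
Let cn1 : continuous n1. Proof. by rewrite /n1; continuity. Qed.
Let cn2 : continuous n2. Proof. by rewrite /n2; continuity. Qed.
Let ctt : continuous tt. Proof. by rewrite /tt; continuity. Qed.

Let tube_map (s : param) : R * R :=
  (p1 s + mu * tt s * n1 s, p2 s + mu * tt s * n2 s).

Let continuous_tube_map : continuous tube_map.
Proof.
have pairc (f h : param -> R) : continuous f -> continuous h ->
    continuous (fun s => (f s, h s)).
  by move=> cf ch s; exact: (cvg_pair (cf s) (ch s)).
by apply: pairc; continuity.
Qed.

Let box (N : nat) : set param :=
  ((`[0, N%:R] `*` `[0, N%:R]) `*` (`[-1, 1] `*` `[-1, 1])) `*` `[-1, 1].

Let tube (N : nat) : set param := box N `&`
  ([set s | dt (p1 s) (p2 s) = 0] `&`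
  ([set s | n1 s ^+ 2 + n2 s ^+ 2 = 1] `&`
   [set s | n1 s * derive1 (fun y => dt (p1 s) y) (p2 s) =
            n2 s * derive1 (fun x => dt x (p2 s)) (p1 s)])).

Let compact_tube N : compact (tube N).
Proof.
apply: compact_closedI.
  have c := @segment_compact R 0 N%:R; have d := @segment_compact R (-1) 1.
  exact (compact_setX (compact_setX (compact_setX c c) (compact_setX d d)) d).
apply: closedI; [|apply: closedI]; apply: closed_eq_continuous.
- exact: continuous_dtilde.
- exact: cst_continuous.
- by continuity.
- exact: cst_continuous.
- by apply: continuous_prod => //; exact: continuous_derive1_dtilde.
- apply: continuous_prod => //.
  rewrite (funext (fun s => derive1_dtildel (p1 s) (p2 s))).
  exact: continuous_derive1_dtilde.
Qed.

Let Cplus_muE : Cplus_mu 1 1 P mu =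
  (fst @^-1` [set x | 0 <= x]) `&` (snd @^-1` [set x | 0 <= x]) `&`
  \bigcup_N (tube_map @` tube N).
Proof.
have unit_itv (x y : R) : x ^+ 2 + y ^+ 2 = 1 -> -1 <= x <= 1.
  move=> xy; rewrite -ler_norml -(ler_pXn2r (n := 2))// ?nnegrE//.
  by rewrite expr1n real_normK ?num_real// -xy lerDl sqr_ge0.
apply/seteqP; split=> [q [q1 q2 [p [n [t [cp [nn nd] t1 qE]]]]]|].
  split => //; move: cp; rewrite CplusE => -[pp1 pp2 dp].
  have bound (x : R) : 0 <= x -> x <= p.1 + p.2 ->
      x \in `[0, (Num.bound (p.1 + p.2))%:R].
    move=> x0 xp; rewrite in_itv/= x0 (le_trans xp)// ltW//.
    by rewrite archi_boundP ?addr_ge0.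
  exists (Num.bound (p.1 + p.2)) => //; exists ((p, n), t) => //.
  split; last by [].
  split; last by rewrite /= in_itv.
  split; split => /=.
  - by apply: bound; rewrite ?lerDl.
  - by apply: bound; rewrite ?lerDr.
  - by rewrite in_itv/= (unit_itv _ _ nn).
  - by rewrite in_itv/= (unit_itv n.2 n.1)// addrC.
move=> q [[q1 q2] [N _ [[[p n] t] [[[[c1 c2] _] t1] [dp [nn nd]]] qE]]].
split => //; exists p, n, t; split => //.
rewrite CplusE; split => //.
- by move: c1; rewrite /= in_itv/= => /andP[].
- by move: c2; rewrite /= in_itv/= => /andP[].
Qed.

(** The curve is unbounded, hence the exhaustion by compact pieces. *)
Lemma measurable_Cplus_mu : measurable (Cplus_mu 1 1 P mu).
Proof.
rewrite Cplus_muE; apply: measurableI.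
  apply: measurableI; rewrite -[X in measurable X]setTI.
  - by apply: measurable_fst => //; rewrite -set_itvcy; exact: measurable_itv.
  - by apply: measurable_snd => //; rewrite -set_itvcy; exact: measurable_itv.
apply: bigcupT_measurable => N; apply: closed_plane_measurable.
apply: compact_closed; first exact: norm_hausdorff.
apply: continuous_compact; last exact: compact_tube.
exact: continuous_subspaceT.
Qed.

Lemma measurable_chi :
  measurable_fun setT (fun p : R * R => chi 1 1 P mu p.1 (- p.1 - p.2) p.2).
Proof.
pose Cm := [set q : R * R |
  Cplus_mu 1 1 P mu q \/ Cplus_mu 1 1 P mu (- q.1, - q.2)].
have mC : measurable Cm.
  apply: measurableU; first exact: measurable_Cplus_mu.
  rewrite -[X in measurable X]setTI.
  apply: (_ : measurable_fun setT (fun q : R * R => (- q.1, - q.2))) => //.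
    by apply/measurable_fun_pairP; split; measurability.
  exact: measurable_Cplus_mu.
have -> : (fun p : R * R => chi 1 1 P mu p.1 (- p.1 - p.2) p.2) = \1_Cm.
  apply/funext => -[x y]; rewrite /chi !indicE; congr (_%:R); congr nat_of_bool.
  apply/idP/idP; rewrite !inE.
    by move=> [[q1 q2] qC [-> _ ->]].
  by move=> pC; exists (x, y).
exact: measurable_indic.
Qed.

End Curve.

(** * Measurability of the kernel *)
Section ComplexMeasurable.
Context {R : realType} {d : measure_display} {T : measurableType d}.
Implicit Types f h : T -> R[i].

Definition cmeasurable f :=
  measurable_fun setT (fun t => complex.Re (f t)) /\
  measurable_fun setT (fun t => complex.Im (f t)).

Lemma cmeasurable_cst (c : R[i]) : cmeasurable (fun=> c).
Proof. by split; exact: measurable_cst. Qed.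

Lemma cmeasurable_real (f : T -> R) :
  measurable_fun setT f -> cmeasurable (fun t => (f t)%:C).
Proof. by move=> mf; split => //; exact: measurable_cst. Qed.

Lemma cmeasurableD f h :
  cmeasurable f -> cmeasurable h -> cmeasurable (fun t => f t + h t).
Proof.
move=> [fr fi] [hr hi]; split.
- by under eq_fun do rewrite raddfD; exact: measurable_funD.
- by under eq_fun do rewrite raddfD; exact: measurable_funD.
Qed.

Lemma cmeasurableM f h :
  cmeasurable f -> cmeasurable h -> cmeasurable (fun t => f t * h t).
Proof.
move=> [fr fi] [hr hi]; split.
- have -> : (fun t => complex.Re (f t * h t)) = (fun t =>
      complex.Re (f t) * complex.Re (h t)
      - complex.Im (f t) * complex.Im (h t)).
    by apply/funext => t; case: (f t) => ? ?; case: (h t).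
  by apply: measurable_funB; exact: measurable_funM.
- have -> : (fun t => complex.Im (f t * h t)) = (fun t =>
      complex.Re (f t) * complex.Im (h t)
      + complex.Im (f t) * complex.Re (h t)).
    by apply/funext => t; case: (f t) => ? ?; case: (h t).
  by apply: measurable_funD; exact: measurable_funM.
Qed.

Lemma cmeasurableB f h :
  cmeasurable f -> cmeasurable h -> cmeasurable (fun t => f t - h t).
Proof.
move=> mf mh; under eq_fun do rewrite -mulN1r.
by apply: cmeasurableD => //; apply: cmeasurableM => //; exact: cmeasurable_cst.
Qed.

Lemma cmeasurableV (f : T -> R) :
  measurable_fun setT f -> cmeasurable (fun t => (f t)%:C^-1).
Proof.
move=> mf; under eq_fun do rewrite -fmorphV.
by apply: cmeasurable_real; exact: (measurableT_comp measurable_invr mf).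
Qed.
End ComplexMeasurable.

Section MeasurableK3.
Context {R : realType} {P : R}.
Context {d : measure_display} {T : measurableType d}.
Implicit Types f : T -> R.

Lemma measurable_omega f :
  measurable_fun setT f -> measurable_fun setT (fun t => omega 1 1 P (f t)).
Proof.
move=> mf; apply: (measurableT_comp measurable_sqrt).
apply: measurable_funM; last by measurability.
exact: measurableT_comp.
Qed.

Lemma measurable_a f :
  measurable_fun setT f -> measurable_fun setT (fun t => a 1 1 P (f t)).
Proof.
move=> mf; apply: (measurableT_comp measurable_sqrt).
apply: measurable_funM; first exact: measurable_omega.
apply: (measurableT_comp measurable_invr); exact: measurableT_comp.
Qed.

Lemma measurable_Sker f1 f2 f3 :
  measurable_fun setT f1 -> measurable_fun setT f2 -> measurable_fun setT f3 ->
  measurable_fun setT (fun t => Sker 1 1 P (f1 t) (f2 t) (f3 t)).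
Proof.
move=> m1 m2 m3; apply: measurable_funM.
  by apply: measurable_funD; apply: measurable_funM => //;
    exact: measurableT_comp.
apply: measurable_funM; first by apply: measurable_funM; exact: measurable_a.
by apply: (measurableT_comp measurable_invr); exact: measurable_a.
Qed.
End MeasurableK3.

Lemma cubic_functional_K3 {R : realType} {P : R} (P0 : 0 <= P) (P2 : P < 2)
    (mu : R) : cubic_functional (K3 1 1 P mu).
Proof.
split; first exact: homogeneous_cubic_int.
move=> l1 l2 l3 f; rewrite -/(cmeasurable f) /f /K3 /cubic_int.
have m1 := @measurable_fst _ _ R R.
have m3 := @measurable_snd _ _ R R.
have m2 : measurable_fun setT (fun p : R * R => - p.1 - p.2) by measurability.
have [w1 w2 w3] := And3 (measurable_omega (P := P) _ m1)
  (measurable_omega (P := P) _ m2) (measurable_omega (P := P) _ m3).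
apply: cmeasurableM.
  apply: cmeasurableM; first exact: cmeasurable_cst.
  by apply: cmeasurable_real; exact: measurable_Sker.
apply: cmeasurableD; [apply: cmeasurableB|].
- apply: cmeasurableM; first exact: cmeasurable_cst.
  by apply: cmeasurableV; measurability.
- apply: cmeasurableM; first exact: cmeasurable_cst.
  apply: cmeasurableM; first exact: cmeasurable_cst.
  by apply: cmeasurableV; measurability.
- apply: cmeasurableM.
    apply: cmeasurable_real; apply: measurable_funB.
      exact: measurable_cst.
    exact: measurable_chi.
  apply: cmeasurableM; first exact: cmeasurable_cst.
  by apply: cmeasurableV; measurability.
Qed.

Theorem proposition4p1 (R : realType) (g D P mu : R)
    (hg : g = 1) (hD : D = 1) (hP : 0 <= P < 2) (hmu : 0 < mu) :
  [/\ cubic_functional (K3 g D P mu),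
      eq_cubic (poisson (K3 g D P mu) (H2 g D P)) (H3NoRes g D P mu),
      forall K : functional R zvar, cubic_functional K ->
        eq_cubic (poisson K (H2 g D P)) (H3NoRes g D P mu) ->
        eq_cubic K (K3 g D P mu)
    & eq_cubic (to_etaxi g D P (K3 g D P mu)) (K3etaxi g D P mu)].
Proof.
move: hP => /andP[P0 P2]; rewrite hg hD; split.
- exact: cubic_functional_K3.
- exact: K3_solution.
- exact: K3_unique.
- exact: to_etaxi_K3_eq.
Qed.
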